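(* Let $\lambda_{\mathrm{opt}}:\mathbb{R}^2\to\mathbb{R}$ be the Gabr-Rao optimal lag-window $$\lambda_{\mathrm{opt}}(x,y)=\frac{8}{\alpha(x,y)^2}\,J_2(\alpha(x,y)),\qquad \alpha(x,y)=\frac{2\pi}{\sqrt3}\sqrt{x^2-xy+y^2},$$ extended by continuity to $(0,0)$. Then $\lambda_{\mathrm{opt}}$ cannot be written as $\lambda_{\mathrm{opt}}(x,y)=f(x)f(y)f(x-y)$ for any choice of function $f$; i.e. there is no function $f:\mathbb{R}\to\mathbb{R}$ such that $\lambda_{\mathrm{opt}}(x,y)=f(x)f(y)f(x-y)$ for all $(x,y)\in\mathbb{R}^2$.
   Context: $J_2$ is the second-order Bessel function of the first kind, $$J_2(x)=\sum_{\ell=0}^\infty\frac{(-1)^\ell}{2^{2\ell+2}\,\ell!\,(2+\ell)!}\,x^{2\ell+2}.$$ The continuous extension has $\lambda_{\mathrm{opt}}(0,0)=1$. (The paper introduces $\lambda_{\mathrm{opt}}$ as the inverse Fourier transform of the optimal kernel equal to $\frac{\sqrt3}{\pi^3}\big(1-\frac1{\pi^2}(\omega_1^2+\omega_2^2+\omega_1\omega_2)\big)$ where $\omega_1^2+\omega_2^2+\omega_1\omega_2\le\pi^2$ and $0$ otherwise, and gives the closed form $\lambda_{\mathrm{opt}}(x,y)=\frac{8}{\alpha(x,y)^2}\,J_2(\alpha(x,y))$ with $\alpha(x,y)=\frac{2\pi}{\sqrt3}\sqrt{x^2-xy+y^2}$ for it.) *)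

(* Defs.v *)
(* Stdlib real numbers with Coquelicot. *)
From Stdlib Require Import Reals Factorial Lra Lia.
From Coquelicot Require Import Coquelicot.
Open Scope R_scope.

Definition bessel_J2_coef (l : nat) : R :=
  (-1) ^ l / (2 ^ (2 * l + 2) * INR (fact l) * INR (fact (2 + l))).

Definition bessel_J2_term (x : R) (l : nat) : R :=
  bessel_J2_coef l * x ^ (2 * l + 2).

(* [Series] is total; the sum is a genuine one by [ex_series_bessel_J2]. *)
Definition bessel_J2 (x : R) : R := Series (bessel_J2_term x).

Definition alpha (x y : R) : R :=
  2 * PI / sqrt 3 * sqrt (x ^ 2 - x * y + y ^ 2).

(* The value 1 at the origin is the continuous extension of the closed form:
   see [continuous_lambda_opt]. *)
Definition lambda_opt (x y : R) : R :=
  match Req_EM_T x 0, Req_EM_T y 0 with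
  | left _, left _ => 1
  | _, _ => 8 / alpha x y ^ 2 * bessel_J2 (alpha x y)
  end.

Lemma bessel_J2_den_neq0 l :
  2 ^ (2 * l + 2) * INR (fact l) * INR (fact (2 + l)) <> 0.
Proof.
  repeat apply Rmult_integral_contrapositive_currified;
    try apply INR_fact_neq_0; apply pow_nonzero; lra.
Qed.

Lemma bessel_J2_coef_neq0 l : bessel_J2_coef l <> 0.
Proof.
  unfold bessel_J2_coef, Rdiv.
  apply Rmult_integral_contrapositive_currified.
  - apply pow_nonzero; lra.
  - apply Rinv_neq_0_compat, bessel_J2_den_neq0.
Qed.

Lemma bessel_J2_coef_ratio l :
  bessel_J2_coef (S l) / bessel_J2_coef l
  = - / (4 * (INR l + 1) * (INR l + 3)).
Proof.
  unfold bessel_J2_coef.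
  replace (2 * S l + 2)%nat with (2 + (2 * l + 2))%nat by lia.
  replace (2 + S l)%nat with (S (2 + l)) by lia.
  rewrite (fact_simpl l), (fact_simpl (2 + l)), !mult_INR, pow_add,
    <- tech_pow_Rmult.
  replace (INR (S (2 + l))) with (INR l + 3)
    by (rewrite S_INR, plus_INR; simpl; ring).
  rewrite (S_INR l).
  pose proof (pos_INR l).
  pose proof (INR_fact_neq_0 l).
  pose proof (INR_fact_neq_0 (2 + l)).
  pose proof (pow_nonzero (-1) l ltac:(lra)).
  pose proof (pow_nonzero 2 (2 * l + 2) ltac:(lra)).
  field; repeat split; try assumption; lra.
Qed.

Lemma CV_radius_bessel_J2 : CV_radius bessel_J2_coef = p_infty.
Proof.
  apply CV_radius_infinite_DAlembert; [exact bessel_J2_coef_neq0|].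
  apply (is_lim_seq_le_le (fun _ => 0) _ (fun n => / INR (S n))).
  - intros n; split; [apply Rabs_pos|].
    rewrite bessel_J2_coef_ratio, Rabs_Ropp.
    pose proof (pos_INR n).
    rewrite Rabs_pos_eq by (apply Rlt_le, Rinv_0_lt_compat; nra).
    rewrite S_INR. apply Rinv_le_contravar; nra.
  - apply is_lim_seq_const.
  - apply (is_lim_seq_incr_1 (fun n => / INR n)).
    replace (Finite 0) with (Rbar_inv p_infty) by reflexivity.
    apply is_lim_seq_inv; [apply is_lim_seq_INR|discriminate].
Qed.

Lemma bessel_J2_termE x l :
  bessel_J2_term x l = x ^ 2 * (bessel_J2_coef l * (x ^ 2) ^ l).
Proof.
  unfold bessel_J2_term.
  rewrite (pow_add x), <- (pow_mult x). ring.
Qed.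

Lemma ex_series_bessel_J2 x : ex_series (bessel_J2_term x).
Proof.
  apply ex_series_ext with
    (fun l => x ^ 2 * (bessel_J2_coef l * (x ^ 2) ^ l)).
  - intros l; symmetry; apply bessel_J2_termE.
  - apply (ex_series_scal (V := R_NormedModule) (x ^ 2)
      (fun l => bessel_J2_coef l * (x ^ 2) ^ l)).
    apply ex_series_Rabs, CV_disk_inside.
    rewrite CV_radius_bessel_J2; exact I.
Qed.

Lemma bessel_J2E x : bessel_J2 x = x ^ 2 * PSeries bessel_J2_coef (x ^ 2).
Proof.
  unfold bessel_J2, PSeries. rewrite <- Series_scal_l.
  apply Series_ext, bessel_J2_termE.
Qed.

Lemma alpha_sqr x y : alpha x y ^ 2 = 4 * PI ^ 2 / 3 * (x ^ 2 - x * y + y ^ 2).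
Proof.
  unfold alpha.
  rewrite Rpow_mult_distr, pow2_sqrt by nra.
  unfold Rdiv. rewrite !Rpow_mult_distr, pow_inv, pow2_sqrt by lra.
  field.
Qed.

Lemma lambda_optE x y :
  lambda_opt x y
  = 8 * PSeries bessel_J2_coef (4 * PI ^ 2 / 3 * (x ^ 2 - x * y + y ^ 2)).
Proof.
  assert (H : x ^ 2 - x * y + y ^ 2 <> 0 ->
    8 / alpha x y ^ 2 * bessel_J2 (alpha x y)
    = 8 * PSeries bessel_J2_coef (4 * PI ^ 2 / 3 * (x ^ 2 - x * y + y ^ 2))).
  { intros Hq. rewrite bessel_J2E, alpha_sqr.
    field. pose proof PI_neq0. split; assumption. }
  unfold lambda_opt.
  destruct (Req_EM_T x 0) as [Hx|Hx]; [destruct (Req_EM_T y 0) as [Hy|Hy]|].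
  - subst.
    replace (4 * PI ^ 2 / 3 * (0 ^ 2 - 0 * 0 + 0 ^ 2)) with 0 by ring.
    rewrite PSeries_0. unfold bessel_J2_coef; simpl. field.
  - apply H. pose proof (pow2_gt_0 y Hy). nra.
  - apply H. pose proof (pow2_gt_0 x Hx). nra.
Qed.

Lemma continuous_lambda_opt (p : R * R) :
  continuous (fun q : R * R => lambda_opt (fst q) (snd q)) p.
Proof.
  apply continuous_ext with (fun q : R * R => 8 * PSeries bessel_J2_coef
    (4 * PI ^ 2 / 3 * (fst q * fst q - fst q * snd q + snd q * snd q))).
  - intros q. rewrite lambda_optE. do 3 f_equal; ring.
  - assert (H1 : continuous (fun q : R * R => fst q) p) by apply continuous_fst.
    assert (H2 : continuous (fun q : R * R => snd q) p) by apply continuous_snd.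
    apply (continuous_mult (fun _ => 8)); [apply continuous_const|].
    apply (continuous_comp (fun q : R * R => 4 * PI ^ 2 / 3 *
      (fst q * fst q - fst q * snd q + snd q * snd q))).
    + apply (continuous_mult (fun _ => 4 * PI ^ 2 / 3));
        [apply continuous_const|].
      apply (continuous_plus
        (fun q : R * R => fst q * fst q - fst q * snd q)
        (fun q : R * R => snd q * snd q)).
      * apply (continuous_minus
          (fun q : R * R => fst q * fst q) (fun q : R * R => fst q * snd q));
          apply (continuous_mult (K := R_AbsRing)); assumption.
      * apply (continuous_mult (K := R_AbsRing)); assumption.
    + apply continuity_pt_filterlim, PSeries_continuity.
      rewrite CV_radius_bessel_J2; exact I.
Qed.

(* Main.v *)
(* If [lambda_opt x y = f x * f y * f (x - y)], the origin gives [f 0 ^ 3 = 1],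
   so [f 0 > 0] and [lambda_opt x 0 = f 0 * f x ^ 2 >= 0] for every [x]. But [J_2] takes
   negative values, for instance at 6. *)
Require Import Defs.
From Stdlib Require Import Reals Lra Lia.
From Coquelicot Require Import Coquelicot.
Open Scope R_scope.

Lemma bessel_J2_coefS l :
  bessel_J2_coef (S l) = - bessel_J2_coef l / (4 * (INR l + 1) * (INR l + 3)).
Proof.
  pose proof (bessel_J2_coef_neq0 l) as H0.
  replace (bessel_J2_coef (S l))
    with (bessel_J2_coef (S l) / bessel_J2_coef l * bessel_J2_coef l)
    by (field; exact H0).
  rewrite bessel_J2_coef_ratio. unfold Rdiv. ring.
Qed.

(* The terms at 36 = 6 ^ 2 decrease in absolute value from index 2 on only. *)
Definition alt_term (n : nat) : R :=
  (-1) ^ n * (bessel_J2_coef (2 + n) * 36 ^ (2 + n)).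

(** The two factors [(-1) ^ n] cancel, so the alternating series of [alt_term] is the tail of the
    power series at 36 from index 2 on. *)
Lemma tg_alt_alt_term n :
  tg_alt alt_term n = bessel_J2_coef (2 + n) * 36 ^ (2 + n).
Proof.
  unfold tg_alt, alt_term.
  rewrite <- Rmult_assoc, <- Rpow_mult_distr.
  replace (-1 * -1) with 1 by ring. rewrite pow1. ring.
Qed.

(** The factor is 36 / (4 (l + 1) (l + 3)) at l = n + 2. It is positive and at most 9 / 15, which
    yields both positivity and monotonicity of [alt_term]. *)
Lemma alt_termS n :
  alt_term (S n) = alt_term n * (9 / ((INR n + 3) * (INR n + 5))).
Proof.
  unfold alt_term.
  replace (2 + S n)%nat with (S (2 + n)) by lia.
  rewrite bessel_J2_coefS, <- !tech_pow_Rmult, plus_INR.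
  change (INR 2) with 2.
  pose proof (pos_INR n).
  field. lra.
Qed.

Lemma bessel_J2_coef0 : bessel_J2_coef 0 = / 8.
Proof. unfold bessel_J2_coef; simpl; field. Qed.

Lemma alt_term0 : alt_term 0 = 27 / 64.
Proof.
  unfold alt_term; simpl Nat.add.
  rewrite !bessel_J2_coefS, bessel_J2_coef0. simpl. field.
Qed.

Lemma alt_term_pos n : 0 < alt_term n.
Proof.
  induction n as [|n IH].
  - rewrite alt_term0. lra.
  - rewrite alt_termS. pose proof (pos_INR n).
    apply Rmult_lt_0_compat; [exact IH|].
    apply Rdiv_lt_0_compat; nra.
Qed.

Lemma alt_term_decreasing : Un_decreasing alt_term.
Proof.
  intros n. rewrite alt_termS.
  pose proof (alt_term_pos n). pose proof (pos_INR n).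
  rewrite <- (Rmult_1_r (alt_term n)) at 2.
  apply Rmult_le_compat_l; [lra|].
  apply Rle_div_l; nra.
Qed.

Lemma ex_series_bessel_J2_coef t :
  ex_series (fun l => bessel_J2_coef l * t ^ l).
Proof.
  apply ex_series_Rabs, CV_disk_inside.
  rewrite CV_radius_bessel_J2; exact I.
Qed.

Lemma ex_series_tg_alt_alt_term : ex_series (tg_alt alt_term).
Proof.
  apply ex_series_ext with (fun n => bessel_J2_coef (2 + n) * 36 ^ (2 + n)).
  - intros n; symmetry; apply tg_alt_alt_term.
  - apply (ex_series_incr_n (fun l => bessel_J2_coef l * 36 ^ l) 2),
      ex_series_bessel_J2_coef.
Qed.

(** Terms of a convergent series tend to 0, and absolute values remove the sign. *)
Lemma alt_term_cv0 : Un_cv alt_term 0.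
Proof.
  apply is_lim_seq_Reals, is_lim_seq_abs_0.
  apply is_lim_seq_ext with (fun n => Rabs (tg_alt alt_term n)).
  - intros n. unfold tg_alt. rewrite Rabs_mult, pow_1_abs. ring.
  - apply (proj1 (is_lim_seq_abs_0 (tg_alt alt_term))).
    apply ex_series_lim_0, ex_series_tg_alt_alt_term.
Qed.

Lemma PSeries_bessel_J2_36_lt0 : PSeries bessel_J2_coef 36 < 0.
Proof.
  (* The terms of index 0 and 1 add up to 1/8 - 3/8 = -1/4, so the tail must stay below 1/4. Partial
     sums ending at an even index bound it from above: three terms give about 0.264, too much, while
     five give about 0.244. *)
  assert (Hle : Series (tg_alt alt_term) <= sum_f_R0 (tg_alt alt_term) (2 * 2)).
  { apply (alternated_series_ineq alt_term);
      [exact alt_term_decreasing|exact alt_term_cv0|].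
    apply is_series_Reals, Series_correct, ex_series_tg_alt_alt_term. }
  unfold PSeries.
  rewrite (Series_incr_n _ 2) by (try lia; apply ex_series_bessel_J2_coef).
  rewrite <- (Series_ext _ _ tg_alt_alt_term).
  revert Hle. unfold tg_alt at 2. simpl.
  rewrite !alt_termS, alt_term0, bessel_J2_coefS, bessel_J2_coef0. simpl.
  lra.
Qed.

Lemma lambda_opt_lt0 : exists x, lambda_opt x 0 < 0.
Proof.
  (* This solves 4 PI^2 / 3 * x^2 = 36, that is, [alpha x 0] = 6. *)
  exists (3 * sqrt 3 / PI).
  rewrite lambda_optE.
  replace (4 * PI ^ 2 / 3 * _) with 36.
  - pose proof PSeries_bessel_J2_36_lt0. lra.
  - pose proof PI_neq0.
    replace ((3 * sqrt 3 / PI) ^ 2) with (9 * sqrt 3 ^ 2 / PI ^ 2)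
      by (field; assumption).
    rewrite pow2_sqrt by lra. field. assumption.
Qed.

Theorem corollary1 :
  ~ (exists f : R -> R,
       forall x y : R, lambda_opt x y = f x * f y * f (x - y)).
Proof.
  intros [f Hf].
  assert (Hf0 : f 0 * f 0 * f 0 = 1).
  { pose proof (Hf 0 0) as H. rewrite Rminus_0_r in H. rewrite <- H.
    unfold lambda_opt. destruct (Req_EM_T 0 0); [reflexivity|lra]. }
  destruct lambda_opt_lt0 as [x Hx].
  rewrite Hf, Rminus_0_r in Hx.
  assert (0 < f 0) by nra.
  pose proof (Rmult_le_pos _ _ (Rlt_le _ _ H) (Rle_0_sqr (f x))) as Hpos.
  unfold Rsqr in Hpos. lra.
Qed.
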